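(* Let $G$ be a graph on $n\ge 7$ vertices and let $\ell$ be the number of vertices of maximum degree in $G$. Then for every integer $r\ge 1$ with $r\ne n-\ell$, the $K_r$-count $\mathrm{k}_r(G)$ is reconstructible from $n-1$ cards.
   Context: Graphs are finite and simple. For a graph $G$ and $v\in V(G)$, the card $G-v$ is the unlabelled induced subgraph $G[V(G)\setminus\{v\}]$ (i.e. considered up to isomorphism). The deck $\mathcal{D}(G)$ is the multiset of all cards $G-v$, $v\in V(G)$. The $K_r$-count $\mathrm{k}_r(G)$ is the number of $r$-element vertex subsets of $G$ that induce a complete graph. A quantity $f(G)$ of an $n$-vertex graph $G$ is reconstructible from $n-1$ cards if for every graph $H$ which has at least $n-1$ cards in common with $G$ (decks compared as multisets of isomorphism classes) we have $f(H)=f(G)$. *)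

(* Defs.v *)
From mathcomp Require Import all_boot.
From mathcomp Require Import finmap multiset.

Set Implicit Arguments.
Unset Strict Implicit.
Unset Printing Implicit Defensive.

Record sgraph := SGraph {
  vertex :> finType;
  adj : rel vertex;
  adj_sym : symmetric adj;
  adj_irr : irreflexive adj }.

Definition isomorphic (G H : sgraph) : Prop :=
  exists2 h : G -> H, bijective h & {mono h : x y / adj x y}.

Lemma relpre_sym (T U : Type) (f : U -> T) (e : rel T) :
  symmetric e -> symmetric (relpre f e).
Proof. by move=> e_sym x y; apply: e_sym. Qed.

Lemma relpre_irr (T U : Type) (f : U -> T) (e : rel T) :
  irreflexive e -> irreflexive (relpre f e).
Proof. by move=> e_irr x; apply: e_irr. Qed.

Definition induced (G : sgraph) (A : {set G}) : sgraph :=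
  @SGraph {x : G | x \in A} (relpre val (@adj G))
    (@relpre_sym _ _ val _ (@adj_sym G)) (@relpre_irr _ _ val _ (@adj_irr G)).

(* An isomorphism class of graphs on m vertices is encoded by the set of the
   (ordered) edge sets on 'I_m of all its labelled copies; see unlabel_eqP. *)
Definition unlabelled : choiceType :=
  {m : nat & {set {set 'I_m * 'I_m}}}.

Definition labellings (G : sgraph) (m : nat) : {set {set 'I_m * 'I_m}} :=
  [set [set p : 'I_m * 'I_m | adj (f p.1) (f p.2)]
     | f : {ffun 'I_m -> G} & injectiveb f].

Definition unlabel (G : sgraph) : unlabelled :=
  existT _ #|G| (labellings G #|G|).

Lemma unlabel_eqP (G H : sgraph) : unlabel G = unlabel H <-> isomorphic G H.
Proof.
have sub m (A B : sgraph) : isomorphic A B -> labellings A m \subset labellings B m.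
  case=> h /bij_inj h_inj h_mono; apply/subsetP=> _ /imsetP[f f_inj ->].
  apply/imsetP; exists [ffun i => h (f i)].
    rewrite inE; apply/injectiveP=> i j; rewrite !ffunE => /h_inj.
    by move: f_inj; rewrite inE => /injectiveP; apply.
  by apply/setP=> p; rewrite !inE !ffunE h_mono.
split=> [eGH | isoGH]; last first.
  have isoHG : isomorphic H G.
    have [h [g hK gK] h_mono] := isoGH.
    exists g; first by exists h.
    by move=> x y; rewrite -h_mono !gK.
  have eqGH : #|G| = #|H|.
    by have [h h_bij _] := isoGH; apply: bij_eq_card h_bij.
  rewrite /unlabel eqGH; congr existT.
  by apply/eqP; rewrite eqEsubset !sub.
have labH u : u = unlabel H -> forall E, E \in tagged u ->
    exists f : 'I_(tag u) -> H, [/\ bijective f &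
      forall p, (p \in E) = adj (f p.1) (f p.2)].
  move=> -> E /= /imsetP[f f_inj ->]; exists f; split.
    move: f_inj; rewrite inE => /injectiveP f_inj.
    by apply: inj_card_bij f_inj _; rewrite card_ord.
  by move=> p; rewrite inE.
pose e : {ffun 'I_#|G| -> G} := [ffun i => enum_val i].
have e_in : [set p : 'I_#|G| * 'I_#|G| | adj (e p.1) (e p.2)]
    \in labellings G #|G|.
  apply/imsetP; exists e => //; rewrite inE; apply/injectiveP=> i j.
  by rewrite !ffunE => /enum_val_inj.
have [f [f_bij fE]] := labH _ eGH _ e_in.
exists (f \o enum_rank); first exact: bij_comp f_bij (@enum_rank_bij G).
move=> x y; have := fE (enum_rank x, enum_rank y).
by rewrite inE !ffunE /= !enum_rankK => <-.
Qed.

Definition card_graph (G : sgraph) (v : G) : sgraph := induced [set~ v].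

Definition deck (G : sgraph) : ({mset unlabelled})%mset :=
  seq_mset [seq unlabel (card_graph v) | v : G].

Definition common_cards (G H : sgraph) : nat :=
  size (deck G `&` deck H)%mset.

Definition reconstructible_from (T : Type) (f : sgraph -> T) (k : nat)
    (G : sgraph) : Prop :=
  forall H : sgraph, k <= common_cards G H -> f H = f G.

Definition clique (G : sgraph) (K : {set G}) : bool :=
  [forall x in K, forall y in K, (x != y) ==> adj x y].

Definition kcount (r : nat) (G : sgraph) : nat :=
  #|[set K : {set G} | (#|K| == r) && clique K]|.

Definition degree (G : sgraph) (v : G) : nat := #|[set w : G | adj v w]|.

Definition max_degree (G : sgraph) : nat := \max_(v : G) degree v.

Definition num_max_degree (G : sgraph) : nat :=
  #|[set v : G | degree v == max_degree G]|.

(* Main.v *)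
(* Take complements, so that [k_r] counts independent [r]-sets and maximum
   degree becomes minimum degree [m], and identify the two vertex sets so that
   the cards at every vertex but one, [z], agree.  If the two counts differ by
   [D], then the numbers of independent [r]-sets through [i] differ by [D] for
   [i != z], and by [(r - n + 1) D] for [z].

   For [r = 2] this makes the degrees differ by 1 off [z] and by [n - 3] at
   [z], which the degree sequences of the cards exclude when [n >= 7]; hence
   the degree sequences agree.

   For general [r], a neighbour of [i] of degree [m] is recognised in the card
   at [i] as a vertex of degree [m - 1], and the independent [r]-sets through
   it are then visible in that card.  Counting minimum-degree vertices by the
   number of independent [r]-sets through them, the cards determine
   everything but the contribution of the neighbours of [z].
   - If [z] is not of minimum degree, looking at the largest such number gives
     [m <= 1], and a recurrence on leaves gives the result by induction on [r].
   - If it is, either the total over the [l] minimum-degree vertices agrees,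
     which means [(l + r - n) D = 0], or all the neighbours of [z] have minimum
     degree and lie in the same number of independent [r]-sets.  Since the
     multiset of these numbers is almost invariant under translation by [D],
     the multiplicity of a value is at most 2, so [m <= 2], and these cases
     are settled by hand. *)
Require Import Defs.
From mathcomp Require Import all_boot.
From mathcomp Require Import fingroup perm finmap multiset zify.

Set Implicit Arguments.
Unset Strict Implicit.
Unset Printing Implicit Defensive.

(** * Independent sets and partially hypomorphic relations *)

Section Counting.

Variable T : finType.
Implicit Types (e f : rel T) (K : {set T}) (p : {perm T}) (r : nat).

Definition simple e := symmetric e /\ irreflexive e.

Definition nbr e x : {set T} := [set y | e x y].
Definition deg e x := #|nbr e x|.
Definition card_deg e i x := #|nbr e x :\ i|.
Definition compl e : rel T := fun x y => (x != y) && ~~ e x y.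

Definition indep e K := [forall x in K, forall y in K, ~~ e x y].
Definition indeps e r := [set K : {set T} | (#|K| == r) && indep e K].
Definition indeps_at e r x := [set K in indeps e r | x \in K].
Definition indeps_off e r x := [set K in indeps e r | x \notin K].

(** [p] permutes all of [T], so it acts on vertex sets directly; edges at [i] are unconstrained, so
    only the cards at [i] are compared. *)
Definition card_iso e f i p :=
  p i = i /\ forall x y, x != i -> y != i -> f (p x) (p y) = e x y.

Lemma indepP e K : reflect {in K &, forall x y, ~~ e x y} (indep e K).
Proof.
apply: (iffP forall_inP) => [eK x y xK yK | eK x xK].
  exact: (forall_inP (eK x xK)).
by apply/forall_inP => y; apply: eK.
Qed.

Lemma deg_card_deg e i x : deg e x = card_deg e i x + e x i.
Proof. by rewrite /deg (cardsD1 i) inE addnC. Qed.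

Lemma simple_compl e : simple e -> simple (compl e).
Proof.
by case=> es ei; split=> [x y | x]; rewrite /compl ?eqxx // eq_sym es.
Qed.

Lemma deg_compl e x : simple e -> (deg e x + deg (compl e) x).+1 = #|T|.
Proof.
case=> es ei; rewrite -(cardsC (nbr e x)) (cardsD1 x (~: _)) !inE ei /= addnCA.
congr (_.+1); congr (_ + _); apply: eq_card => y.
by rewrite !inE /compl eq_sym.
Qed.

Lemma card_indeps e r x : #|indeps e r| = #|indeps_at e r x| + #|indeps_off e r x|.
Proof.
rewrite -(cardsID [set K : {set T} | x \in K]); congr (_ + _).
  by apply: eq_card => K; rewrite !inE.
by apply: eq_card => K; rewrite !inE andbC.
Qed.

Lemma sum_indeps_at e r : \sum_x #|indeps_at e r x| = r * #|indeps e r|.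
Proof.
under eq_bigr => x _ do rewrite -sum1_card.
rewrite (exchange_big_dep (mem (indeps e r))) /=; last first.
  by move=> x K _; rewrite inE => /andP[].
rewrite mulnC -sum_nat_const; apply: eq_bigr => K iK.
transitivity #|K|; last by move: iK; rewrite inE => /andP[/eqP].
rewrite -sum1_card; apply: eq_bigl => x; rewrite inE iK //.
Qed.

Section CardIso.

Variables (e f : rel T) (i : T) (p : {perm T}).
Hypothesis ep : card_iso e f i p.

Lemma card_iso_eq x : (p x == i) = (x == i).
Proof. by case: ep => pi _; rewrite -{1}pi (inj_eq perm_inj). Qed.

Lemma card_iso_sym : card_iso f e i p^-1.
Proof.
have [pi ef] := ep; split=> [|x y xi yi]; first by rewrite -{1}pi permK.
by rewrite -ef ?permKV // -card_iso_eq permKV.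
Qed.

Lemma card_iso_compl : card_iso (compl e) (compl f) i p.
Proof.
have [pi ef] := ep; split=> // x y xi yi.
by rewrite /compl ef // (inj_eq perm_inj).
Qed.

Lemma card_iso_card_deg x : x != i -> card_deg f i (p x) = card_deg e i x.
Proof.
have [pi ef] := ep => xi; rewrite /card_deg -[RHS](card_imset _ (@perm_inj _ p)).
apply: eq_card => y; apply/idP/imsetP => [|[y0]].
  rewrite !inE => /andP[yi fy]; exists (p^-1 y)%g; last by rewrite permKV.
  have y0i : (p^-1)%g y != i by rewrite -card_iso_eq permKV.
  by rewrite !inE y0i -ef // permKV.
by rewrite !inE => /andP[yi fy] ->; rewrite card_iso_eq yi ef.
Qed.

Lemma card_iso_count_deg (P : pred nat) :
  #|[set x | (x != i) && P (card_deg f i x)]|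
  = #|[set x | (x != i) && P (card_deg e i x)]|.
Proof.
rewrite -(card_preimset _ (@perm_inj _ p)); apply: eq_card => x.
rewrite !inE card_iso_eq; case xi: (x == i) => //=.
by rewrite card_iso_card_deg ?xi.
Qed.

Lemma card_iso_indeps r K :
  i \notin K -> (p @: K \in indeps f r) = (K \in indeps e r).
Proof.
have [pi ef] := ep => iK; rewrite !inE card_imset ?perm_inj //; last exact: perm_inj.
congr (_ && _); have neqi x : x \in K -> x != i by apply: contraTneq => ->.
apply/indepP/indepP => [fK x y xK yK | eK _ _ /imsetP[x xK ->] /imsetP[y yK ->]].
  by rewrite -ef ?neqi // fK ?imset_f.
by rewrite ef ?neqi // eK.
Qed.

Lemma card_iso_indeps_off r : #|indeps_off f r i| = #|indeps_off e r i|.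
Proof.
have [pi ef] := ep.
have pinj : injective (fun K : {set T} => p @: K) by apply: imset_inj perm_inj.
rewrite -(card_preimset _ pinj); apply: eq_card => K.
rewrite !inE /= -{1}pi mem_imset ?perm_inj //; last exact: perm_inj.
case iK: (i \in K) => /=; first by rewrite !andbF.
by have := @card_iso_indeps r K; rewrite !inE iK => -> //.
Qed.

(** An independent set through a neighbour of [i] avoids [i], so it lies in the card at [i]. *)
Lemma card_iso_indeps_at r x :
  simple e -> simple f -> e i x -> f i (p x) ->
  #|indeps_at f r (p x)| = #|indeps_at e r x|.
Proof.
move=> [es ei] [fs fi] eix fix_.
have pinj : injective (fun K : {set T} => p @: K) by apply: imset_inj perm_inj.
have [pi ef] := ep; rewrite -(card_preimset _ pinj); apply: eq_card => K.
rewrite [LHS]inE [LHS]inE [RHS]inE /=.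
rewrite [X in _ && X]mem_imset ?perm_inj //; last exact: perm_inj.
case xK: (x \in K); rewrite ?andbF // !andbT.
case iK: (i \in K); last by rewrite card_iso_indeps ?iK.
rewrite !inE; case: indepP => [fK|_]; case: indepP => [eK|_]; rewrite ?andbF //.
- by have := eK _ _ iK xK; rewrite eix.
- by have := fK _ _ (imset_f p iK) (imset_f p xK); rewrite pi fix_.
- by have := eK _ _ iK xK; rewrite eix.
Qed.

End CardIso.

Lemma card_iso_full e f i p r :
  simple e -> simple f -> card_iso e f i p ->
  (forall x, f i (p x) = e i x) -> #|indeps f r| = #|indeps e r|.
Proof.
move=> [es ei] [fs fi] [pi ef] nb.
have pinj : injective (fun K : {set T} => p @: K) by apply: imset_inj perm_inj.
have efp x y : f (p x) (p y) = e x y.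
  have [-> | xi] := eqVneq x i; first by rewrite pi nb.
  have [-> | yi] := eqVneq y i; last exact: ef.
  by rewrite pi fs nb es.
rewrite -(card_preimset _ pinj); apply: eq_card => K.
rewrite !inE card_imset; last exact: perm_inj.
congr (_ && _); apply/indepP/indepP.
  by move=> fK x y xK yK; rewrite -efp fK ?imset_f.
by move=> eK _ _ /imsetP[x xK ->] /imsetP[y yK ->]; rewrite efp eK.
Qed.

Record hypomorphic e f z : Prop := Hypomorphic {
  hypo_simple_l : simple e;
  hypo_simple_r : simple f;
  hypo_iso : forall i, i != z -> exists p, card_iso e f i p }.

Lemma hypo_sym e f z : hypomorphic e f z -> hypomorphic f e z.
Proof.
by case=> se sf ef; split=> // i /ef[p /card_iso_sym]; exists p^-1%g.
Qed.

Lemma hypo_compl e f z : hypomorphic e f z -> hypomorphic (compl e) (compl f) z.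
Proof.
case=> se sf ef; split=> [||i /ef[p /card_iso_compl]]; try exact: simple_compl.
by exists p.
Qed.

(** Sets avoiding [i] lie in the card at [i], so the whole surplus [D] sits on the sets through
    [i]. *)
Lemma hypo_shift e f z r D i :
  hypomorphic e f z -> #|indeps e r| = #|indeps f r| + D ->
  i != z -> #|indeps_at e r i| = #|indeps_at f r i| + D.
Proof.
case=> se sf ef eD iz; have [p /card_iso_indeps_off/(_ r)] := ef i iz.
by move: eD; rewrite (card_indeps e r i) (card_indeps f r i); lia.
Qed.

(** Summing over all vertices counts each independent set [r] times; removing the shift [D] at the
    [n - 1] other vertices leaves [z]. Stated additively because subtraction truncates. *)
Lemma hypo_shift_missing e f z r D :
  hypomorphic e f z -> #|indeps e r| = #|indeps f r| + D ->
  #|indeps_at f r z| + r * D = #|indeps_at e r z| + #|T|.-1 * D.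
Proof.
move=> ef eD; have := sum_indeps_at e r; have := sum_indeps_at f r.
rewrite (bigD1 z) //= => fr; rewrite (bigD1 z) //= eD.
rewrite (eq_bigr (fun i => #|indeps_at f r i| + D)) => [|i iz]; last first.
  exact: hypo_shift eD iz.
rewrite big_split /= sum_nat_const cardC1 mulnDr -fr -!addnA.
by rewrite addnCA [in RHS]addnCA => /addnI->.
Qed.

End Counting.

(** * Reconstruction of the degree sequence *)

Section Degrees.

Variable T : finType.
Implicit Types (e f : rel T) (x y z : T).

Lemma exists_notin (s : seq T) : size s < #|T| -> exists x, x \notin s.
Proof.
move=> lts; have [x xs|sT] := pickP [pred x | x \notin s]; first by exists x.
have Ts : #|T| <= #|s|.
  by apply/subset_leq_card/subsetP => x _; apply/negbFE/sT.
by have := leq_trans lts (leq_trans Ts (card_size s)); rewrite ltnn.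
Qed.

(* The non-neighbour of [x], when unique; [x] itself if there is none. *)
Definition miss e x := odflt x [pick y | (y != x) && ~~ e x y].

Lemma missP e x y :
  simple e -> #|T| <= (deg e x).+2 -> y != x -> ~~ e x y -> y = miss e x.
Proof.
move=> se; rewrite -(deg_compl x se) => d1 yx exy.
have {}d1 : #|nbr (compl e) x| <= 1 by move: d1; rewrite /deg; lia.
rewrite /miss; case: pickP => [y' /andP[y'x exy']|/(_ y)]; last by rewrite yx exy.
by apply: (card_le1_eqP d1); rewrite inE /compl eq_sym ?yx ?y'x.
Qed.

Lemma deg_lt e x : simple e -> deg e x < #|T|.
Proof. by move/(deg_compl x); lia. Qed.

Lemma deg_fullP e x y : simple e -> #|T| <= (deg e x).+1 -> y != x -> e x y.
Proof.
move=> se; rewrite -(deg_compl x se) => d0 yx; apply: contraT => exy.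
have /eqP : #|nbr (compl e) x| = 0 by move: d0; rewrite /deg; lia.
by rewrite cards_eq0 => /eqP/setP/(_ y); rewrite !inE /compl eq_sym yx exy.
Qed.

Lemma hypo_deg e f z i : hypomorphic e f z -> i != z ->
  exists p : {perm T}, forall x, x != i ->
    p x != i /\ deg f (p x) + e i x = deg e x + f i (p x).
Proof.
case=> [[es _] [fs _] ef] /ef[p ep]; exists p => x xi.
rewrite (card_iso_eq ep) (deg_card_deg f i) (deg_card_deg e i).
rewrite (card_iso_card_deg ep xi) es fs; split=> //; lia.
Qed.

(** [z] dominates every other card of [f], which forces two dominating vertices in [e], necessarily
    the two neighbours of [z]. In a suitable card both could only correspond to [z] in [f]. *)
Lemma dominating_missing_absurd e f z :
  hypomorphic e f z -> 7 <= #|T| -> (forall i, i != z -> deg e i = (deg f i).+1) ->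
  deg e z = 2 -> (deg f z).+1 = #|T| -> False.
Proof.
move=> h n7 ef ez fz; have [se sf _] := h; have [es ei] := se; have [fs _] := sf.
have /cards2P[a [b [ab nz]]] : #|nbr e z| == 2 by apply/eqP.
have nzE x : e z x = (x == a) || (x == b).
  by have := in_set2 x a b; rewrite -nz inE.
have step i : i != z -> exists2 x, x != i & deg e x + 2 = #|T| + e i x.
  move=> iz; have [p /(_ z)] := hypo_deg (hypo_sym h) iz.
  rewrite eq_sym iz => /(_ isT)[pz]; rewrite fs (deg_fullP sf) ?fz // => pE.
  by exists (p z) => //; lia.
have zx x : #|T| <= (deg e x).+1 -> x != z -> e z x.
  by move=> dx xz; rewrite es (deg_fullP se) // eq_sym.
(* With these vertices avoided, the vertex dominating the card of [e] at [i] dominates all of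
   [e]. *)
have [i] := @exists_notin [:: z; miss e a; miss e b] (leq_trans (isT : 3 < 7) n7).
rewrite !inE !negb_or => /and3P[iz ia ib].
have [w wi wE] := step i iz.
have wz : w != z by apply: contraTneq n7 => w_z; rewrite w_z ez in wE; lia.
have wdom : #|T| <= (deg e w).+1.
  case eiw: (e i w) wE => [|]; first by lia.
  move=> wE; have miss_w y : y != w -> ~~ e w y -> y = miss e w.
    by move=> *; apply: missP => //; clear -wE; lia.
  have i_w : i = miss e w by apply: miss_w; rewrite 1?eq_sym // es eiw.
  case: (boolP (e z w)) => [|ezw]; last first.
    by case/eqP: iz; rewrite i_w -(miss_w z) // 1?eq_sym // es.
  by rewrite nzE => /orP[]/eqP w_; rewrite i_w w_ eqxx in ia ib.
(* As [w] is dominating, [w'] is adjacent to it and hence dominating as well. *)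
have [w' w'w w'E] := step w wz.
have w'dom : #|T| <= (deg e w').+1 by move: w'E; rewrite (deg_fullP se wdom) //; lia.
have w'z : w' != z by apply: contraTneq n7 => w_z; rewrite w_z ez in w'dom; clear -w'dom; lia.
have dom_ww' y : e z y -> y = w \/ y = w'.
  have := zx _ wdom wz; have := zx _ w'dom w'z; rewrite !nzE.
  move=> /orP[]/eqP w'a /orP[]/eqP wa /orP[]/eqP ->; move: w'w;
    by rewrite w'a wa ?eqxx //; auto.
have [j] := @exists_notin [:: z; w; w'; miss f w; miss f w'] (leq_trans (isT : 5 < 7) n7).
rewrite !inE !negb_or => /and5P[jz jw jw' jfw jfw'].
have [p pE] := hypo_deg h jz.
(* Off [z], the image has degree [n - 2] in [f] and so dominates [e]: it is [w] or [w'], and [j]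
   would be the vertex it misses in [f], which was excluded. *)
have absurd x : x = w \/ x = w' -> p x != z -> False.
  move=> xw pxz.
  have [|pxj] := pE x; first by case: xw => ->; rewrite eq_sym.
  have dx : #|T| <= (deg e x).+1 by case: xw => ->.
  have -> : e j x by rewrite es (deg_fullP se) //; case: xw => ->.
  have := ef _ pxz; have := deg_lt (p x) se.
  case fjx: (f j (p x)) => d1 d2 d3; first by clear -d1 d2 d3 dx; lia.
  have /dom_ww' pxw : e z (p x) by apply: zx => //; clear -d3 d2 dx; lia.
  have jx : j = miss f (p x).
    by apply: missP; rewrite ?(fs _ j) ?fjx // 1?eq_sym //; clear -d3 d2 dx; lia.
  by case: pxw => pxw; rewrite pxw in jx; rewrite -jx eqxx in jfw jfw'.
have [pw|pw] := eqVneq (p w) z; last by apply: absurd pw; left.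
apply: (absurd w'); first by right.
by rewrite -pw (inj_eq perm_inj).
Qed.

(** A dominating [w] has degree [n - 2] in the card at [i]; its image in [f] is [z] or [w] and
    misses exactly [i], which the choice of [i] excludes. *)
Lemma no_dominating e f z w :
  hypomorphic e f z -> 7 <= #|T| -> (forall i, i != z -> deg e i = (deg f i).+1) ->
  deg e z = 1 -> (deg f z).+2 = #|T| -> (deg e w).+1 < #|T|.
Proof.
move=> h n7 ef ez fz; have [se sf _] := h; have [es ei] := se; have [fs _] := sf.
rewrite ltnNge; apply/negP => wdom.
have /cards1P[a nz] : #|nbr e z| == 1 by apply/eqP.
have nzE x : e z x = (x == a) by have := in_set1 x a; rewrite -nz inE.
have zx x : #|T| <= (deg e x).+1 -> x != z -> x = w.
  have zx y : #|T| <= (deg e y).+1 -> y = a.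
    have [->|yz] := eqVneq y z; first by rewrite ez; lia.
    by move=> dy; apply/eqP; rewrite -nzE es (deg_fullP se) // eq_sym.
  by move=> /zx -> _; rewrite (zx w).
have wz : w != z by apply: contraTneq n7 => w_z; rewrite w_z ez in wdom; lia.
have [i] := @exists_notin [:: z; w; miss f z; miss f w] (leq_trans (isT : 4 < 7) n7).
rewrite !inE !negb_or => /and4P[iz iw ifz ifw].
have [p pE] := hypo_deg h iz.
have [|pwi] := pE w; first by rewrite eq_sym.
have -> : e i w by rewrite es (deg_fullP se).
have [-> d | pwz] := eqVneq (p w) z.
  case fiz: (f i z) d; first by lia.
  by move=> _; case/eqP: ifz; apply: missP; rewrite // ?fz // fs fiz.
have := ef _ pwz; have := deg_lt (p w) se.
case fiw: (f i (p w)) => d1 d2 d3; first by clear -d1 d2 d3 wdom; lia.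
have pw : p w = w by apply: zx => //; lia.
rewrite pw in fiw d2 d3.
case/eqP: ifw; apply: missP; rewrite ?(fs _ i) ?fiw // 1?eq_sym //.
by clear -d2 d3 wdom; lia.
Qed.

End Degrees.

(** * The missing vertex of degree 1 in one graph and [n - 2] in the other *)

Section LeafMissing.

Variable T : finType.
Implicit Types (e f : rel T) (x y z : T).

Lemma hypo_sum_card_deg e f z i (u : nat -> nat) : hypomorphic e f z -> i != z ->
  \sum_(x | x != i) u (card_deg f i x) = \sum_(x | x != i) u (card_deg e i x).
Proof.
case=> _ _ ef /ef[p ep]; rewrite (reindex_inj (@perm_inj _ p)).
apply: eq_big => x; first by rewrite (card_iso_eq ep).
by rewrite (card_iso_eq ep) => xi; rewrite (card_iso_card_deg ep).
Qed.

Lemma card_degE e i x : simple e -> card_deg e i x = deg e x - e i x.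
Proof. by case=> es _; rewrite (deg_card_deg e i x) es addnK. Qed.

Lemma leaf_missing_absurd n e f z :
  #|T| = n -> hypomorphic e f z -> 7 <= n -> (forall i, i != z -> deg e i = (deg f i).+1) ->
  deg e z = 1 -> (deg f z).+2 = n -> False.
Proof.
move=> nT h n7 ef ez fz; have [se sf _] := h; have [es ei] := se; have [fs fi] := sf.
have eT x : (deg e x + deg (compl e) x).+1 = n by rewrite deg_compl.
have fT x : (deg f x + deg (compl f) x).+1 = n by rewrite deg_compl.
have e_lt x : (deg e x).+1 < n by rewrite -nT (no_dominating x h) ?nT.
(* An isolated vertex of [f] would dominate [compl f]; complementing and exchanging the graphs
   preserves the hypotheses. *)
have f_gt x : 0 < deg f x.
  have := @no_dominating _ _ _ _ x (hypo_compl (hypo_sym h)); rewrite nT.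
  have := eT z; have := fT z; have := fT x => fTx fTz eTz lt.
  have : (deg (compl f) x).+1 < n.
    apply: lt => // [i iz||]; [|lia..].
    by have := eT i; have := fT i; have := ef i iz; lia.
  lia.
have /cards1P[w nz] : #|nbr e z| == 1 by apply/eqP.
have nzE x : e z x = (x == w) by have := in_set1 x w; rewrite -nz inE.
have wz : w != z by apply/eqP => wz; have := ei z; rewrite nzE wz eqxx.
have nfz x : x != z -> ~~ f z x -> x = miss f z by apply: missP; rewrite ?nT ?fz.
(* In the card at [w], [z] is isolated. *)
have [q qz [qw fq fwq]] : exists2 q, q != z & [/\ q != w, deg f q = 1 & f w q].
  have [p /(_ z)] := hypo_deg h wz.
  rewrite eq_sym wz ez es nzE eqxx => /(_ isT)[pzw fpz].
  have := f_gt (p z); case fwp: (f w (p z)) fpz => fpz; last by lia.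
  have fpz1 : deg f (p z) = 1 by lia.
  exists (p z); last by split.
  by apply: contraTneq n7 => pzz; rewrite pzz in fpz1; lia.
have /cards1P[w1 nq] : #|nbr f q| == 1 by apply/eqP.
have nqE x : f q x = (x == w).
  have nqE y : f q y = (y == w1) by have := in_set1 y w1; rewrite -nq inE.
  by rewrite nqE; have := nqE w; rewrite fs fwq => /esym/eqP <-.
have qmiss : q = miss f z by apply: nfz => //; rewrite fs nqE eq_sym.
have fzE x : x != z -> f z x = (x != q).
  move=> xz; have [->|xq] := eqVneq x q; first by rewrite fs nqE eq_sym (negPf wz).
  by apply: contraNT xq => /(nfz _ xz) ->; rewrite qmiss.
have eq2 : deg e q = 2 by rewrite ef // fq.
(* In the card of [f] at [q], [z] is dominating. *)
have [ewn ewq] : (deg e w).+2 = n /\ ~~ e w q.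
  have [p /(_ z)] := hypo_deg (hypo_sym h) qz.
  rewrite eq_sym qz fs fzE // eqxx => /(_ isT)[pzq epz].
  have epz2 : (deg e (p z)).+2 = n by have := e_lt (p z); lia.
  have epq : e q (p z) = false by case: (e q (p z)) epz; lia.
  have pzz : p z != z by apply: contraTneq n7 => pzz; rewrite pzz in epz2; lia.
  have : e z (p z).
    apply: contraT => ezp; case/eqP: qz.
    have missing y : e y (p z) = false -> y != p z -> y = miss e (p z).
      by move=> ey ypz; apply: missP; rewrite ?nT ?epz2 // es ey.
    apply: etrans (missing q epq _) (esym (missing z (negbTE ezp) _)).
      by rewrite eq_sym.
    by rewrite eq_sym.
  by rewrite nzE => /eqP pw; rewrite -pw es epq.
have ew x : x != w -> e w x = (x != q).
  move=> xw; have [->|xq] := eqVneq x q; first exact/negbTE.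
  apply: contraNT xq => ewx; have missing y := @missP _ e w y se.
  apply/eqP/(etrans (missing x _ _ _) (esym (missing q _ _ _))) => //; rewrite ?nT ?ewn //.
have fw3 : (deg f w).+3 = n by have := ef w wz; lia.
(* [c t] counts the vertices losing degree [t] in the card of [f] at [w];
   comparing degree sequences gives [c t = 1] for [3 <= t <= n - 3]. *)
pose O x := [&& x != w, x != z & x != q].
pose c (t : nat) := \sum_(x | O x) ((deg f x == t) && f w x).
have cE (t : nat) : c t + (t == 2) = c t.+1 + (t + 3 == n).
  have split_w u : \sum_(x | x != w) u x = u z + (u q + \sum_(x | O x) u x).
    rewrite (bigD1 z) 1?eq_sym //= (bigD1 q) ?qw //=.
    by congr (_ + (_ + _)); apply: eq_bigl => x; rewrite /O andbA.
  have /esym := hypo_sum_card_deg (fun d => nat_of_bool (d == t)) h wz.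
  rewrite !split_w /=.
  have -> : card_deg e w z = 0 by rewrite card_degE // es nzE eqxx ez.
  have -> : card_deg e w q = 2 by rewrite card_degE // (negPf ewq) eq2.
  have -> : card_deg f w z = (deg f z).-1 by rewrite card_degE // fs fzE // eq_sym qw subn1.
  have -> : card_deg f w q = 0 by rewrite card_degE // fwq fq.
  rewrite (eq_bigr (fun x => nat_of_bool (deg f x == t))); last first.
    move=> x /and3P[xw xz xq]; rewrite card_degE // ef // ew //.
    by rewrite xq subSS subn0.
  have : \sum_(x | O x) (card_deg f w x == t) + c t
       = \sum_(x | O x) (deg f x == t) + c t.+1.
    rewrite -!big_split; apply: eq_bigr => x _ /=; rewrite card_degE //.
    have := f_gt x; case: (f w x) => /= d0; rewrite ?andbF ?andbT ?subn0 //.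
    by clear -d0; lia.
  set A := \sum_(x | _) _; set B := \sum_(x | _) _; clearbody c A B.
  have -> : (t + 3 == n) = ((deg f z).-1 == t).
    by apply/eqP/eqP; clear -fz n7; lia.
  rewrite (eq_sym t); case: (2 == t); case: (0 == t); case: (_ == t); clear; lia.
have c_gt k : k + 6 <= n -> 0 < c k.+3.
  elim: k => [|k IHk] kn; first by have := cE 2; clear -n7; lia.
  by have := cE k.+3; have := IHk (ltnW kn); clear -kn; lia.
have cP t : 0 < c t -> exists2 x, O x & deg f x = t.
  rewrite lt0n sum_nat_eq0 negb_forall => /existsP[x].
  rewrite negb_imply => /andP[Ox]; have [dx _|//] := eqVneq (deg f x) t.
  by exists x.
have [w' /and3P[w'w w'z w'q] w'd] : exists2 x, O x & (deg f x).+3 = n.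
  have [|x Ox xd] := cP _ (c_gt (n - 6) _); first by clear -n7; lia.
  by exists x; rewrite // xd; clear -n7; lia.
(* The degree [n - 4] is at least 3 because [7 <= n]. *)
have [p /and3P[pw pz pq] pd] : exists2 x, O x & (deg f x).+4 = n.
  have [|x Ox xd] := cP _ (c_gt (n - 7) _); first by clear -n7; lia.
  by exists x; rewrite // xd; clear -n7; lia.
(* Double count the vertices of degree [n - 3] over all cards but that of [z]. *)
pose S g x := \sum_(i | i != z) ((x != i) && (card_deg g i x + 3 == n)).
have SE : \sum_x S e x = \sum_x S f x.
  rewrite /S exchange_big [RHS]exchange_big /=; apply: eq_bigr => i iz.
  have := hypo_sum_card_deg (fun d => nat_of_bool (d + 3 == n)) h iz.
  rewrite big_mkcond [RHS]big_mkcond /= => /esym SE.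
  apply: etrans (etrans _ SE) _; apply: eq_bigr => x _; by case: (x != i).
have degS (g : rel T) x : \sum_(i | i != z) g x i + g x z = deg g x.
  rewrite /deg -sum1_card [RHS]big_mkcond [RHS](bigD1 z) //= inE addnC.
  by congr (_ + _); apply: eq_bigr => i _; rewrite inE.
(* Degree [n - 2] becomes [n - 3] in the cards at neighbours; degree [n - 3] is kept in the cards at
   non-neighbours. *)
have S_max x : (deg e x).+2 = n -> deg e x <= S e x + e x z.
  move=> dx; rewrite -degS leq_add2r; apply: leq_sum => i iz.
  rewrite card_degE // es; case: eqP => [<-|_]; first by rewrite ei.
  by case: (e x i) => //; clear -dx n7; lia.
have S_submax x : (deg e x).+3 = n -> 1 <= S e x.
  move=> dx; have := degS (compl e) x; have := eT x => exT.
  have : \sum_(i | i != z) compl e x i <= S e x.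
    apply: leq_sum => i iz; rewrite card_degE // es /compl.
    by case: eqP => //= _; case: (e x i); rewrite //= subn0 addn3 dx eqxx.
  set A := \sum_(i | _) _; move: A => A.
  by case: (compl e x z); clear -exT dx; lia.
have Sf_z : S f z <= deg f z.
  rewrite -degS fi addn0; apply: leq_sum => i iz.
  by rewrite card_degE // fs; case: (f z i); case: eqP => //; rewrite ?subn0; clear -fz; lia.
have Sf_max x : x != z -> S f x <= 2 * ((deg f x).+3 == n).
  move=> xz; case: eqP => dx.
    have := degS (compl f) x; have := fT x => fxT.
    have : S f x <= \sum_(i | i != z) compl f x i.
      apply: leq_sum => i iz; rewrite card_degE // fs /compl.
      case: eqP => //= _; case: (f x i); case: eqP => //.
      by rewrite /= subn1; clear -dx n7; lia.
    move: (S f x) (\sum_(i | i != z) compl f x i) => A B.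
    by clear -fxT dx; lia.
  rewrite [S f x]big1 // => i iz; rewrite card_degE //.
  have := ef x xz; have := e_lt x; do 2!case: eqP => //=.
  by case: (f i x); clear -dx; lia.
pose R x := [&& x != z, x != w, x != w' & x != p].
have split4 (u : T -> nat) :
    \sum_x u x = u z + (u w + (u w' + (u p + \sum_(x | R x) u x))).
  rewrite (bigD1 z) // (bigD1 w) //= (bigD1 w') ?w'w ?w'z //=.
  rewrite (bigD1 p) ?pw ?pz //=.
    by do 4![congr (_ + _)]; apply: eq_bigl => x; rewrite /R !andbA.
  by apply/eqP => pw'; rewrite pw' in pd; clear -pd w'd; lia.
(* The four singled-out vertices contribute at least [(n - 3) + (n - 2) + 1] for [e] and at most
   [(n - 2) + 2 + 2] for [f], and each other vertex at least as much for [e] as for [f]; this is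
   impossible for [7 <= n]. *)
move: SE; rewrite !split4.
have SR : \sum_(x | R x) S f x <= \sum_(x | R x) S e x.
  apply: leq_sum => x /and4P[xz _ _ _]; apply: leq_trans (Sf_max x xz) _.
  case: eqP => // dx; have := S_max x; have := ef x xz.
  by case: (e x z); clear -dx n7; lia.
have := S_max w ewn; have := S_max w'; have := S_submax p.
have := Sf_max w wz; have := Sf_max w' w'z; have := Sf_max p pz.
have -> : e w' z = false by rewrite es nzE (negPf w'w).
have -> : e w z by rewrite es nzE.
rewrite fw3 w'd eqxx (_ : _ == _ = false); last by apply/eqP; clear -pd; lia.
have := ef _ w'z; have := ef _ pz; have := ef _ wz.
move: SR Sf_z; set A := \sum_(x | R x) _; set B := \sum_(x | R x) _.
clearbody A B S; clear -n7 pd w'd fz fw3; lia.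
Qed.

End LeafMissing.

(** * Equality of the degrees *)

Section DegreeSequence.

Variable T : finType.
Implicit Types (e f : rel T) (x y z : T).

(* Complementing and exchanging [e] and [f] preserves the hypotheses and sends
   [deg e z] to [2 - deg e z], so the case [0] reduces to the case [2]. *)
Lemma size_missing_absurd n e f z :
  #|T| = n -> hypomorphic e f z -> 7 <= n ->
  (forall i, i != z -> deg e i = (deg f i).+1) ->
  deg f z + 3 = deg e z + n -> False.
Proof.
move=> nT h n7 ef fz; have [se sf _] := h.
have := deg_lt z sf; rewrite nT => fz_lt.
have : deg e z <= 2 by clear -fz_lt fz; lia.
case ez: (deg e z) => [|[|[|//]]] _.
- apply: (dominating_missing_absurd (hypo_compl (hypo_sym h))); rewrite ?nT //.
  + move=> i iz; have := deg_compl i se; have := deg_compl i sf; rewrite ef //.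
    by clear; lia.
  + by have := deg_compl z sf; clear -fz ez nT n7; lia.
  by have := deg_compl z se; clear -ez nT; lia.
- by apply: (leaf_missing_absurd nT h n7 ef ez); clear -fz ez; lia.
by apply: (dominating_missing_absurd h _ ef ez); clear -fz ez n7 nT; lia.
Qed.

Lemma card_indeps_at2 e x : simple e -> #|indeps_at e 2 x| = deg (compl e) x.
Proof.
case=> es ei.
have inj : {in nbr (compl e) x &, injective (fun y => [set x; y])}.
  move=> y y'; rewrite !inE => /andP[xy _] _ /setP/(_ y).
  by rewrite !inE eqxx orbT eq_sym (negPf xy) => /esym/eqP.
rewrite /deg -(card_in_imset inj); apply: eq_card => K.
apply/idP/imsetP => [|[y yx ->]]; last first.
  move: yx; rewrite !inE eqxx cards2 => /andP[-> exy]; rewrite andbT /=.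
  apply/indepP => a b; rewrite !inE => /orP[]/eqP -> /orP[]/eqP ->;
    by rewrite ?ei // es.
rewrite !inE => /andP[/andP[/cards2P[a [b [ab ->]]] /indepP eK]].
have eab : ~~ e a b by apply: eK; rewrite !inE eqxx ?orbT.
rewrite !inE => /orP[]/eqP ->; [exists b | exists a] => //.
- by rewrite inE /compl ab.
- by rewrite inE /compl eq_sym ab es.
by rewrite setUC.
Qed.

(** Independent pairs through a vertex count its non-neighbours, so the degrees shift by [D] off [z]
    and by [(n - 3) D] the other way at [z]. *)
Lemma hypo_deg_eq e f z : hypomorphic e f z -> 7 <= #|T| -> deg e =1 deg f.
Proof.
wlog le_ef : e f / #|indeps f 2| <= #|indeps e 2|.
  move=> wl h n7; case: (leqP #|indeps f 2| #|indeps e 2|) => [|/ltnW] le_ef.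
    exact: wl.
  by move=> x; rewrite (wl f e) //; apply: hypo_sym.
move=> h; have [se sf _] := h; move nT: #|T| => n n7.
have eD : #|indeps e 2| = #|indeps f 2| + (#|indeps e 2| - #|indeps f 2|).
  by rewrite subnKC.
move: (_ - _) eD => D eD.
have eT x : (deg e x + deg (compl e) x).+1 = n by rewrite deg_compl.
have fT x : (deg f x + deg (compl f) x).+1 = n by rewrite deg_compl.
have sh i : i != z -> deg f i = deg e i + D.
  move=> iz; have := hypo_shift h eD iz; rewrite !card_indeps_at2 //.
  by have := eT i; have := fT i; clear; lia.
have := hypo_shift_missing h eD; rewrite !card_indeps_at2 // nT => shz.
have {shz} : deg e z + 2 * D = deg f z + n.-1 * D.
  by have := eT z; have := fT z; move: (_ * D) (2 * D) shz; clear; lia.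
case: D eD sh => [|[|D]] eD sh shz.
- move=> x; have [->|xz] := eqVneq x z; first by rewrite !muln0 !addn0 in shz.
  by rewrite sh ?addn0.
- case: (size_missing_absurd nT (hypo_sym h) n7 (z := z)) => [i iz|].
    by rewrite sh ?addn1.
  by clear -shz n7; lia.
(* The difference is now [D + 2], and [(n - 3) (D + 2)] exceeds every degree. *)
have : 4 * D <= n.-1 * D by rewrite leq_mul2r; clear -n7; lia.
have := eT z; have := fT z; rewrite !mulnS in shz.
by move: (n.-1 * D) shz; clear -n7; lia.
Qed.

End DegreeSequence.

(** * What the cards show about minimum-degree vertices *)

Section MinimumDegree.

Variables (T : finType) (e f : rel T) (z : T) (m : nat).
Hypotheses (h : hypomorphic e f z) (ef : deg e =1 deg f).
Hypothesis (m_min : forall x, m <= deg e x).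

(** Passing to the card lowers the degree of the neighbours of [i] by one and no other, so only
    those of degree [m] fall below [m]. *)
Lemma min_deg_visible (g : rel T) i x : simple g -> (forall x, m <= deg g x) ->
  g i x && (deg g x == m) = (x != i) && (card_deg g i x < m).
Proof.
move=> [gs gi] gm; have := gm x; rewrite (deg_card_deg g i) gs.
have [->|xi] := eqVneq x i; first by rewrite gi.
by case: (g i x) => /= mx; apply/idP/idP; clear -mx; lia.
Qed.

(** The weight [u] is later the identity, the indicator of one value, or the constant 1. *)
Lemma hypo_sum_min_nbrs r i (u : nat -> nat) : i != z ->
  \sum_(x | e i x && (deg e x == m)) u #|indeps_at e r x|
  = \sum_(x | f i x && (deg f x == m)) u #|indeps_at f r x|.
Proof.
have [se sf isos] := h; move=> /isos[p ep].
have fm x : m <= deg f x by rewrite -ef.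
rewrite [RHS](reindex_inj (@perm_inj _ p)).
have vis x : f i (p x) && (deg f (p x) == m) = e i x && (deg e x == m).
  rewrite !min_deg_visible // (card_iso_eq ep).
  by case xi: (x == i) => //=; rewrite (card_iso_card_deg ep) ?xi.
apply: eq_big => x; first by rewrite vis.
move=> ex; have := ex; rewrite -vis => /andP[fix_ _].
by case/andP: ex => eix _; rewrite (card_iso_indeps_at ep).
Qed.

Lemma sum_min_nbrs (g : rel T) (u : T -> nat) : symmetric g ->
  \sum_i \sum_(x | g i x && (deg g x == m)) u x = m * \sum_(x | deg g x == m) u x.
Proof.
move=> gs; rewrite (exchange_big_dep (fun x => deg g x == m)) /=; last first.
  by move=> i x _ /andP[].
rewrite big_distrr /=; apply: eq_bigr => x /eqP dx.
transitivity (deg g x * u x); last by rewrite dx.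
rewrite -[RHS]/(#|nbr g x| * u x) -sum_nat_const; apply: eq_bigl => i.
by rewrite inE gs dx eqxx andbT.
Qed.

(** Summing over all [i] counts each minimum-degree vertex [m] times, and only the term at [z] may
    differ; its two versions are put crosswise to avoid subtraction. *)
Lemma hypo_sum_min r (u : nat -> nat) :
  m * \sum_(x | deg e x == m) u #|indeps_at e r x|
    + \sum_(x | f z x && (deg f x == m)) u #|indeps_at f r x|
  = m * \sum_(x | deg f x == m) u #|indeps_at f r x|
    + \sum_(x | e z x && (deg e x == m)) u #|indeps_at e r x|.
Proof.
have [[es _] [fs _] _] := h; rewrite -!sum_min_nbrs //.
rewrite (bigD1 z) //= [X in _ = X + _](bigD1 z) //=.
rewrite (eq_bigr _ (fun i iz => hypo_sum_min_nbrs r u iz)).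
by rewrite addnAC [RHS]addnAC [in RHS](addnC (\sum_(x | f z x && _) _)).
Qed.

(** The card at [i] exhibits all neighbours of [i], so the isomorphism of cards extends to the whole
    graphs. *)
Lemma min_deg_nbrs_iso r i : i != z -> deg e i = m ->
  (forall x, e i x -> deg e x = m) -> #|indeps e r| = #|indeps f r|.
Proof.
have [se sf isos] := h; move=> /isos[p ep] im good.
have fm x : m <= deg f x by rewrite -ef.
apply/esym/(card_iso_full r se sf ep) => x.
have eA : nbr e i = [set x | (x != i) && (card_deg e i x < m)].
  apply/setP => y; rewrite !inE -min_deg_visible //.
  by case ey: (e i y) => //=; rewrite good // eqxx.
(* In [f] only an inclusion is clear; equality follows since [i] has the same degree in both
   graphs. *)
have fA : nbr f i = [set x | (x != i) && (card_deg f i x < m)].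
  apply/esym/eqP; rewrite eqEcard (card_iso_count_deg ep (fun d => d < m)).
  rewrite -eA -/(deg e i) ef leqnn andbT; apply/subsetP => y.
  by rewrite !inE -min_deg_visible // => /andP[].
have -> : f i (p x) = (p x \in nbr f i) by rewrite inE.
have -> : e i x = (x \in nbr e i) by rewrite inE.
rewrite eA fA !inE (card_iso_eq ep).
by case xi: (x == i) => //=; rewrite (card_iso_card_deg ep) ?xi.
Qed.

End MinimumDegree.

(** * Comparing the numbers of independent sets *)

Section Recurrences.

Variable T : finType.
Implicit Types (e f g : rel T) (x y z w : T).

Lemma indeps0 e : #|indeps e 0| = 1.
Proof.
apply/eqP/cards1P; exists set0; apply/setP => K; rewrite !inE cards_eq0.
by case: eqP => [->|//]; apply/indepP => x y; rewrite inE.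
Qed.

Lemma indeps_at_succ e r w : simple e ->
  #|indeps_at e r.+1 w|
  = #|[set K in indeps e r | (w \notin K) && [disjoint K & nbr e w]]|.
Proof.
case=> es ei.
set S := [set K in _ | _]; pose add (K : {set T}) := w |: K.
have inj : {in S &, injective add}.
  move=> K K'; rewrite !inE => /and3P[_ wK _] /and3P[_ wK' _] eKK'.
  by rewrite -(setU1K wK) -(setU1K wK') -/(add K) eKK'.
rewrite -(card_in_imset inj); apply: eq_card => K; apply/idP/imsetP.
  rewrite !inE => /andP[/andP[/eqP Kr /indepP eK] wK].
  exists (K :\ w); last by rewrite /add setD1K.
  have Kr' : #|K :\ w| = r by have := cardsD1 w K; rewrite wK Kr; case.
  rewrite !inE Kr' eqxx eqxx /=.
  apply/andP; split.
    by apply/indepP => x y; rewrite !inE => /andP[_ xK] /andP[_ yK]; apply: eK.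
  by apply/pred0P => x; rewrite !inE; apply/negP => /andP[/andP[_ xK]]; apply/negP/eK.
move=> [K']; rewrite !inE => /and3P[/andP[/eqP Kr /indepP eK] wK dK] ->.
rewrite setU11 cardsU1 wK Kr eqxx /= andbT.
have wx x : x \in K' -> ~~ e w x.
  by move=> xK; have := disjointFr dK xK; rewrite inE => ->.
apply/indepP => x y; rewrite !inE => /predU1P[->|xK] /predU1P[->|yK].
- by rewrite ei.
- exact: wx.
- by rewrite es wx.
exact: eK.
Qed.

Lemma indeps_at_succ_isolated e r w : simple e -> deg e w = 0 ->
  #|indeps_at e r.+1 w| + #|indeps_at e r w| = #|indeps e r|.
Proof.
move=> se /eqP; rewrite cards_eq0 => /eqP w0.
rewrite (card_indeps e r w) addnC indeps_at_succ //; congr (_ + _).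
apply: eq_card => K; rewrite !inE w0.
by rewrite disjoints_subset setC0 subsetT andbT.
Qed.

(** An independent [r]-set contains exactly one of [w] and [z], or avoids both; in the last case
    adding [w] gives an [r.+1]-set through [w]. *)
Lemma indeps_at_succ_leaf e r z w : simple e -> e z w -> deg e w = 1 ->
  #|indeps_at e r.+1 w| + #|indeps_at e r w| + #|indeps_at e r z| = #|indeps e r|.
Proof.
move=> se ezw; have [es ei] := se => /eqP/cards1P[z' nw].
have {z'}nw : nbr e w = [set z].
  by have := in_set1 z z'; rewrite -nw inE es ezw nw => /esym/eqP->.
rewrite (card_indeps e r w) addnAC addnC; congr (_ + _).
rewrite -(cardsID [set K : {set T} | z \in K] (indeps_off e r w)) addnC.
rewrite (indeps_at_succ r w se) nw; congr (_ + _); apply: eq_card => K.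
  rewrite !inE -!andbA; case: eqP => //= _; case: indepP => //= eK.
  case zK: (z \in K); rewrite ?andbF ?andbT //; apply/esym/negP => wK.
  by have := eK _ _ zK wK; rewrite ezw.
by rewrite !inE disjoint_sym disjoints1 andbC -!andbA andbC -!andbA.
Qed.

End Recurrences.

(** * The missing vertex is not of minimum degree *)

Section MissingNotMinimal.

Variable T : finType.
Implicit Types (e f : rel T) (x y z : T) (m r : nat).

(** Off [z] all terms shift by the same amount in the same direction, so a nonzero difference cannot
    cancel. *)
Lemma hypo_indeps_eq_of_sum e f z r (P : pred T) x0 :
  hypomorphic e f z -> P x0 -> ~~ P z ->
  \sum_(x | P x) #|indeps_at e r x| = \sum_(x | P x) #|indeps_at f r x| ->
  #|indeps e r| = #|indeps f r|.
Proof.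
wlog lt_fe : e f / #|indeps f r| < #|indeps e r|.
  move=> wl h Px0 Pz eq_sum.
  case: (ltngtP #|indeps f r| #|indeps e r|) => [lt|lt|//]; first exact: wl.
  by apply/esym/wl => //; apply: hypo_sym.
move=> h Px0 Pz eq_sum; have := ltnn (\sum_(x | P x) #|indeps_at e r x|).
rewrite {1}eq_sum (bigD1 x0) //= [X in _ < X](bigD1 x0) //= -addSn leq_add //.
  have x0z : x0 != z by apply: contraNneq Pz => <-.
  by rewrite (hypo_shift h (esym (subnKC (ltnW lt_fe))) x0z) -addn1 leq_add2l subn_gt0.
apply: leq_sum => x /andP[Px _]; have xz : x != z by apply: contraNneq Pz => <-.
by rewrite (hypo_shift h (esym (subnKC (ltnW lt_fe))) xz) leq_addr.
Qed.

Lemma missing_not_min_le1 e f z m r D x0 :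
  hypomorphic e f z -> deg e =1 deg f -> (forall x, m <= deg e x) ->
  deg e z != m -> deg e x0 = m ->
  #|indeps e r| = #|indeps f r| + D -> 0 < D -> m <= 1.
Proof.
move=> h ef m_min ez /eqP ex0 eD D0.
pose w x := #|indeps_at e r x|.
have [x1 ex1 x1max] : exists2 x1, deg e x1 == m & forall x, deg e x == m -> w x <= w x1.
  by have [x1 ex1 x1max] := @arg_maxnP T x0 (fun x => deg e x == m) w ex0; exists x1.
(* No minimum-degree vertex of [f] attains the largest value [w x1], so [m] times its multiplicity
   in [e] is at most its multiplicity among the neighbours of [z]. *)
have := hypo_sum_min h ef m_min r (fun d => nat_of_bool (d == w x1)).
rewrite [X in _ = m * X + _]big1 ?muln0 ?add0n; last first.
  move=> x; rewrite -ef => ex; have xz : x != z by apply: contraNneq ez => <-.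
  apply/eqP; rewrite eqb0 neq_ltn; apply/orP; left.
  by apply: leq_trans (x1max x ex); rewrite /w (hypo_shift h eD xz) -addn1 leq_add2l.
set S := \sum_(x | deg e x == m) _ => SE.
have S0 : 0 < S by rewrite /S (bigD1 x1) // eqxx.
suff : m * S <= 1 * S by rewrite leq_pmul2r.
move: SE; set B := \sum_(x | f z x && _) _ => SE; rewrite mul1n.
apply: leq_trans (leq_addr B _) _; rewrite SE /S big_mkcond [X in _ <= X]big_mkcond.
by apply: leq_sum => x _; case: (e z x) => //=; case: ifP.
Qed.

(** Equality at [r] gives equal totals over the leaves at [z]; the leaf recurrence lifts these to
    [r.+1], and the weighted count passes to all leaves, among which [z] is not. *)
Lemma missing_not_min_leaf e f z x0 r :
  hypomorphic e f z -> deg e =1 deg f -> (forall x, 1 <= deg e x) ->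
  deg e z != 1 -> deg e x0 = 1 -> #|indeps e r| = #|indeps f r|.
Proof.
move=> h ef m_min ez /eqP ex0; have [se sf _] := h.
elim: r => [|r IHr]; first by rewrite !indeps0.
have eD : #|indeps e r| = #|indeps f r| + 0 by rewrite addn0.
have eq_at x : #|indeps_at e r x| = #|indeps_at f r x|.
  have [->|xz] := eqVneq x z; last by rewrite (hypo_shift h eD xz) addn0.
  by have := hypo_shift_missing h eD; rewrite !muln0 !addn0.
apply: (@hypo_indeps_eq_of_sum e f z r.+1 (fun x => deg e x == 1) x0) => //.
have sumE (s : nat) (u : nat -> nat) := hypo_sum_min h ef m_min s u.
have fE u : \sum_(x | deg f x == 1) u x = \sum_(x | deg e x == 1) u x :> nat.
  by apply: eq_bigl => x; rewrite ef.
have := sumE r.+1 id; have := sumE r id; have := sumE 0 (fun _ => 1).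
rewrite /= !mul1n !fE (eq_bigr _ (fun x _ => eq_at x)) => /addnI eq1 /addnI eqr eqr1.
have leaf g : simple g -> \sum_(x | g z x && (deg g x == 1)) #|indeps_at g r.+1 x|
    + \sum_(x | g z x && (deg g x == 1)) #|indeps_at g r x|
    + \sum_(x | g z x && (deg g x == 1)) 1 * #|indeps_at g r z|
    = \sum_(x | g z x && (deg g x == 1)) 1 * #|indeps g r|.
  move=> sg; rewrite -!big_split; apply: eq_bigr => x /andP[gzx /eqP gx] /=.
  by rewrite !mul1n (indeps_at_succ_leaf _ sg).
have := leaf e se; have := leaf f sf; rewrite -!big_distrl /= -eq1 -eqr -IHr eq_at => <-.
by move/addIn/addIn => eqr'; move: eqr1; rewrite eqr' => /addIn.
Qed.

Lemma missing_not_min e f z m r x0 :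
  hypomorphic e f z -> deg e =1 deg f -> (forall x, m <= deg e x) ->
  deg e z != m -> deg e x0 = m -> #|indeps e r| = #|indeps f r|.
Proof.
wlog lt_fe : e f / #|indeps f r| < #|indeps e r|.
  move=> wl h ef m_min ez ex0.
  case: (ltngtP #|indeps f r| #|indeps e r|) => [lt|lt|//]; first exact: wl.
  apply/esym/wl; rewrite -?ef //; first exact: hypo_sym.
  by move=> x; rewrite -ef.
move=> h ef m_min ez ex0.
have := missing_not_min_le1 h ef m_min ez ex0 (esym (subnKC (ltnW lt_fe))).
rewrite subn_gt0 => /(_ lt_fe); case: m m_min ez ex0 => [|[|//]] m_min ez ex0 _.
  have [se _ _] := h; apply: (min_deg_nbrs_iso h ef m_min r _ ex0) => [|x].
    by apply: contraNneq ez => <-; rewrite ex0.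
  by move: ex0 => /eqP; rewrite cards_eq0 => /eqP/setP/(_ x); rewrite !inE => ->.
exact: (missing_not_min_leaf r h ef m_min ez ex0).
Qed.

End MissingNotMinimal.

(** If no value were more frequent under [g], the equal number of terms would force equal multisets,
    hence equal sums. *)
Lemma sum_neq_count (T : finType) (P : pred T) (g h : T -> nat) :
  \sum_(x | P x) g x <> \sum_(x | P x) h x ->
  exists t, \sum_(x | P x) (h x == t) < \sum_(x | P x) (g x == t).
Proof.
move=> neq; pose s u := [seq u x | x <- enum P] : seq nat.
have cE (u : T -> nat) (t : nat) : \sum_(x | P x) (u x == t) = count_mem t (s u).
  rewrite -sum1_count big_map [RHS]big_mkcond big_enum /=.
  by apply: eq_bigr => x _; case: (u x == t).
(* A finite range suffices, as [g] takes no value above its maximum. *)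
have [s_le|] := boolP [forall t : 'I_(\max_(x | P x) g x).+1,
    count_mem (t : nat) (s g) <= count_mem (t : nat) (s h)].
  case: neq.
  have /count_subseqP[s' ss' gs'] : forall t, count_mem t (s g) <= count_mem t (s h).
    move=> t; case: (ltnP t (\max_(x | P x) g x).+1) => tm.
      exact: (forallP s_le (Ordinal tm)).
    rewrite -cE big1 // => x Px; apply/eqP; rewrite eqb0 ltn_eqF //.
    by apply: leq_trans tm; apply: leq_bigmax_cond.
  have : s' == s h.
    by rewrite -(size_subseq_leqif ss') -(perm_size gs') !size_map.
  move=> /eqP s'E; rewrite s'E in gs'.
  have := perm_big _ gs' (op := addn) (x := 0) (P := xpredT) (F := id).
  by rewrite !big_map !big_enum.
by rewrite negb_forall => /existsP[t]; rewrite -ltnNge => lt; exists (val t); rewrite !cE.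
Qed.

(** * The missing vertex is of minimum degree *)

Section MissingMinimal.

Variable T : finType.
Implicit Types (e f : rel T) (x y z : T) (m r : nat).

(** With [l] minimum-degree vertices, those other than [z] contribute [(l - 1) D] and [z]
    contributes [(r - n + 1) D], in total [(l + r - n) D]. *)
Lemma hypo_sum_min_shift e f z m r D :
  hypomorphic e f z -> deg e z = m -> #|indeps e r| = #|indeps f r| + D ->
  \sum_(x | deg e x == m) #|indeps_at e r x| + #|T| * D
  = \sum_(x | deg e x == m) #|indeps_at f r x| + (#|[set x | deg e x == m]| + r) * D.
Proof.
move=> h /eqP ez eD; have := hypo_shift_missing h eD => shz.
rewrite (cardsD1 z) inE ez (bigD1 z) // [in RHS](bigD1 z) //=.
rewrite (eq_bigr (fun x => #|indeps_at f r x| + D)) => [|x /andP[_ xz]]; last first.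
  exact: (hypo_shift h eD xz).
rewrite big_split /= sum_nat_const.
have -> : #|[set x | deg e x == m] :\ z| = #|fun x => (deg e x == m) && (x != z)|.
  by apply: eq_card => x; rewrite !inE andbC.
move: #|fun x => _| => k; have : 0 < #|T| by apply/card_gt0P; exists z.
case: #|T| shz => // n; rewrite !mulnDl !mulSn /= => shz _.
move: (r * D) (n * D) (k * D) shz => rD nD kD; set S := \sum_(_ | _) _.
by clear; lia.
Qed.

(** A second isolated vertex identifies the graph. Otherwise [l = 1], which excludes [r = n - 1];
    for [r >= n] both counts vanish, and below [n - 1] the recurrence at [z] allows induction. *)
Lemma missing_isolated e f z r :
  hypomorphic e f z -> deg e =1 deg f -> deg e z = 0 -> 1 < #|T| ->
  #|[set x | deg e x == 0]| + r != #|T| -> #|indeps e r| = #|indeps f r|.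
Proof.
move=> h ef ez n1 rn; have [se sf _] := h.
have [i /andP[iz /eqP ei]|only] := pickP [pred i | (i != z) && (deg e i == 0)].
  apply: (min_deg_nbrs_iso h ef _ r iz ei) => // x.
  by move: ei => /eqP; rewrite cards_eq0 => /eqP/setP/(_ x); rewrite !inE => ->.
have {}rn : r != #|T|.-1.
  apply: contraNneq rn => ->; rewrite (_ : [set x | _] = [set z]) ?cards1 ?add1n ?prednK //.
    exact: ltnW.
  apply/setP => x; rewrite !inE; have [->|xz] := eqVneq x z; first by rewrite ez.
  by have := only x; rewrite /= xz.
have large (g : rel T) : simple g -> deg g =1 deg e -> #|T| <= r -> #|indeps g r| = 0.
  move=> [gs gi] ge rT; apply/eqP; rewrite cards_eq0; apply/eqP/setP => K.
  rewrite !inE; apply/negP => /andP[/eqP Kr /indepP gK].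
  have KT x : x \in K.
    have /eqP -> : K == setT by rewrite eqEcard subsetT cardsT Kr.
    by rewrite inE.
  have [x xz] := @exists_notin T [:: z] n1.
  have := only x; rewrite /= -ge; rewrite inE in xz; rewrite xz /= => /negP[].
  by rewrite cards_eq0; apply/eqP/setP => y; rewrite !inE; apply/negbTE/gK.
have [rT|] := leqP #|T| r; first by rewrite !large // => x; rewrite ef.
move=> rT; have {rT rn} : r < #|T|.-1 by rewrite ltn_neqAle rn -ltnS prednK // ltnW.
clear large; elim: r => [|r IHr] rT; first by rewrite !indeps0.
have {}IHr := IHr (ltnW rT).
have eD : #|indeps e r| = #|indeps f r| + 0 by rewrite addn0.
have at_r : #|indeps_at e r z| = #|indeps_at f r z|.
  by have := hypo_shift_missing h eD; rewrite !muln0 !addn0.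
have at_r1 : #|indeps_at e r.+1 z| = #|indeps_at f r.+1 z|.
  have := indeps_at_succ_isolated r se ez; rewrite ef in ez.
  by rewrite at_r IHr -(indeps_at_succ_isolated r sf ez) => /addIn.
(* With equality at [z], a difference [D] satisfies [r.+1 * D = n.-1 * D], and [r.+1 < n.-1]. *)
have absurd (g g' : rel T) : hypomorphic g g' z ->
    #|indeps_at g r.+1 z| = #|indeps_at g' r.+1 z| ->
    #|indeps g' r.+1| < #|indeps g r.+1| -> False.
  move=> hg eq_at lt.
  have := hypo_shift_missing hg (esym (subnKC (ltnW lt))); rewrite eq_at.
  by move/addnI/eqP; rewrite eqn_pmul2r ?subn_gt0 // ltn_eqF.
case: (ltngtP #|indeps f r.+1| #|indeps e r.+1|) => // lt.
  by case: (absurd e f).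
by case: (absurd f e) => //; apply: hypo_sym.
Qed.

(** A surplus of the value [t] is multiplied by [m] in the weighted count, and only the neighbours
    of [z] in [e] can absorb it; there are just [m] of them. *)
Lemma missing_nbrs_concentrated e f z m r t :
  hypomorphic e f z -> deg e =1 deg f -> (forall x, m <= deg e x) -> deg e z = m ->
  \sum_(x | deg e x == m) (#|indeps_at f r x| == t)
    < \sum_(x | deg e x == m) (#|indeps_at e r x| == t) ->
  forall x, e z x -> deg e x = m /\ #|indeps_at e r x| = t.
Proof.
move=> h ef m_min ez lt.
have := hypo_sum_min h ef m_min r (fun d => nat_of_bool (d == t)).
rewrite (_ : \sum_(x | deg f x == m) _
    = \sum_(x | deg e x == m) (#|indeps_at f r x| == t)); last first.
  by apply: eq_bigl => x; rewrite ef.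
move: lt; set A := \sum_(_ | _) _; set B := \sum_(_ | _) _ => lt SE.
pose S := [set x in nbr e z | (deg e x == m) && (#|indeps_at e r x| == t)].
have SS : \sum_(x | e z x && (deg e x == m)) (#|indeps_at e r x| == t) = #|S|.
  rewrite -sum1_card big_mkcond [RHS]big_mkcond; apply: eq_bigr => x _.
  by rewrite !inE; case: (e z x); case: (_ == m); case: (_ == t).
have /eqP nS : S == nbr e z.
  rewrite eqEcard; apply/andP; split.
    by apply/subsetP => x; rewrite inE => /andP[].
  rewrite -/(deg e z) ez -SS -(leq_add2l (m * A)) -SE.
  apply: leq_trans (leq_addr _ _).
  by rewrite -mulnSr leq_mul2l lt orbT.
move=> x; have : (x \in S) = e z x by rewrite nS inE.
by rewrite inE => <- /andP[_ /andP[/eqP-> /eqP->]].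
Qed.

Lemma missing_min_le2 e f z m r D t :
  hypomorphic e f z -> deg e =1 deg f -> (forall x, m <= deg e x) -> deg e z = m ->
  0 < m -> #|indeps e r| = #|indeps f r| + D -> 0 < D ->
  (forall x, e z x -> deg e x = m /\ #|indeps_at e r x| = t) -> m <= 2.
Proof.
move=> h ef m_min ez m0 eD D0 nz.
pose B s := \sum_(x | (deg e x == m) && (x != z)) (#|indeps_at e r x| == s).
pose c := #|indeps_at f r z|.
(* Off [z], value [s] in [f] is value [s + D] in [e]; the corrections come from [z] in [f] and from
   the neighbours of [z] in [e], all of value [t]. *)
have B_le s : B s <= B (s + D) + (c == s) + (t == s).
  have := hypo_sum_min h ef m_min r (fun d => nat_of_bool (d == s)).
  rewrite (bigD1 z) ?ez //= -/(B s).
  rewrite [X in _ = _ * X + _ -> _](bigD1 z) -?ef ?ez //= -/c.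
  rewrite (_ : \sum_(x | _ && (x != z)) _ = B (s + D)); last first.
    apply: eq_big => x; first by rewrite ef.
    by case/andP => _ xz; rewrite (hypo_shift h eD xz) eqn_add2r.
  have : \sum_(x | e z x && (deg e x == m)) (#|indeps_at e r x| == s) <= m * (t == s).
    have -> : m = #|nbr e z| by rewrite -ez.
    rewrite -sum_nat_const big_mkcond [X in _ <= X]big_mkcond /=.
    apply: leq_sum => x _; rewrite inE; case ezx: (e z x) => //=.
    by have [_ ->] := nz x ezx; case: ifP.
  set Q := \sum_(x | e z x && _) _ => le.
  set Q' := \sum_(x | f z x && _) _; rewrite -(leq_pmul2l m0) !mulnDr.
  move: Q Q' (m * B s) (m * B (s + D)) (m * (c == s)) (m * (t == s)) (m * (_ == s)) le.
  by clear; lia.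
(* Going up in steps of [D] past the maximum meets each correction at most once; [k] bounds the
   remaining distance. *)
have Ble k s : (\max_x #|indeps_at e r x|) < s + k -> B s <= (s <= c) + (s <= t).
  elim: k s => [|k IHk] s lt.
    rewrite [B s]big1 // => x _; apply/eqP; rewrite eqb0 ltn_eqF //.
    rewrite addn0 in lt; apply: leq_ltn_trans lt.
    exact: (@leq_bigmax T (fun x => #|indeps_at e r x|) x).
  apply: leq_trans (B_le s) _.
  have : (\max_x #|indeps_at e r x|) < (s + D) + k.
    by apply: leq_trans lt _; rewrite addnS -addSn leq_add2r -addn1 leq_add2l.
  move/IHk; move: (B (s + D)); clear -D0.
  case: (leqP (s + D) c); case: (leqP (s + D) t); case: (eqVneq c s); case: (eqVneq t s);
    case: (leqP s c); case: (leqP s t); lia.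
have : m <= B t.
  rewrite -ez /deg -sum1_card big_mkcond [B t]big_mkcond /=.
  apply: leq_sum => x _; rewrite inE; case: ifP => // ezx.
  have [-> ->] := nz x ezx; rewrite !eqxx /=.
  case: eqP => // xz; have [[_ ei] _ _] := h.
  by rewrite xz ei in ezx.
move/leq_trans; apply; apply: leq_trans (Ble (\max_x #|indeps_at e r x|).+1 t _) _.
  by rewrite addnS ltnS leq_addl.
by rewrite leqnn; case: (t <= _).
Qed.

End MissingMinimal.

(** * Minimum degree two and the end of the minimal case *)

Section MissingDegreeTwo.

Variable T : finType.
Implicit Types (e f : rel T) (x y z : T) (m r : nat).

Lemma deg2P e x y : deg e x = 2 -> e x y ->
  exists2 y', y' != y & forall v, e x v = (v == y) || (v == y').
Proof.
move=> /eqP/cards2P[a [b [ab nx]]] exy.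
have ex v : e x v = (v == a) || (v == b) by have := in_set2 v a b; rewrite -nx inE.
have := ex y; rewrite exy => /esym/orP[]/eqP ->.
  by exists b; rewrite // eq_sym.
by exists a => // v; rewrite ex orbC.
Qed.

(* Independent 3-sets of [compl e] are triangles of [e]: either the card at [w]
   identifies [z], or restoring [w] closes a triangle in [f] but not in [e]. *)
Lemma deg_min_nbrs2 e f z w r :
  hypomorphic e f z -> deg e =1 deg f -> (forall x, 2 <= deg e x) ->
  (forall x, e z x -> deg e x = 2) -> deg e z = 2 -> e z w ->
  (forall i, i != z -> deg e i = 2 -> exists2 x, e i x & deg e x != 2) ->
  (forall i, i != z -> deg f i = 2 -> exists2 x, f i x & deg f x != 2) ->
  #|indeps_at e r z| = #|indeps_at f r z|
  \/ #|indeps (compl e) 3| < #|indeps (compl f) 3|.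
Proof.
move=> h ef m_min nz ez ezw bad_e bad_f.
have [se sf isos] := h; have [es ei] := se; have [fs fi] := sf.
have fm x : 2 <= deg f x by rewrite -ef.
have ew := nz w ezw; have wz : w != z by apply: contraTneq ezw => ->; rewrite ei.
have [w2 w2w zE] := deg2P ez ezw.
have ezw2 : e z w2 by rewrite zE eqxx orbT.
have ew2 := nz w2 ezw2.
have w2z : w2 != z by apply: contraTneq ezw2 => ->; rewrite ei.
have [a az wE] := deg2P ew (etrans (es w z) ezw).
have ea : deg e a != 2.
  have [x] := bad_e w wz ew; rewrite wE => /orP[]/eqP -> //.
  by rewrite ez.
have eww2 : e w w2 = false.
  by rewrite wE (negPf w2z) /=; apply: contraNF ea => /eqP <-; rewrite ew2.
have [p ep] := isos w wz; have [pw efp] := ep.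
have vis x : f w (p x) && (deg f (p x) == 2) = e w x && (deg e x == 2).
  rewrite !(@min_deg_visible _ 2) // (card_iso_eq ep).
  by case xw: (x == w) => //=; rewrite (card_iso_card_deg ep) ?xw.
have /andP[fwz /eqP fz] : f w (p z) && (deg f (p z) == 2).
  by rewrite vis es ezw ez.
have zw : z != w by rewrite eq_sym.
have fzw2 : f (p z) (p w2) by rewrite efp.
have dw2 : deg f (p w2) = 2 + f w (p w2).
  rewrite (deg_card_deg f w) (card_iso_card_deg ep) // fs; congr (_ + _).
  by have := deg_card_deg e w w2; rewrite ew2 es eww2 addn0.
case fww2: (f w (p w2)); [right | left]; last first.
  (* Otherwise [p z] is a vertex other than [z] whose two neighbours [w] and [p w2] both have degree
     2, against [bad_f]. *)
  have pz : p z = z.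
    apply/eqP; apply: contraT => pzz; have [x] := bad_f _ pzz fz.
    have [y yw pzE] := deg2P fz (etrans (fs _ _) fwz).
    have := pzE (p w2); rewrite fzw2 (card_iso_eq ep) (negPf w2w) => /esym/eqP yE.
    by rewrite pzE -yE => /orP[]/eqP ->; rewrite ?dw2 ?fww2 // -ef ew.
  have := card_iso_indeps_at ep r se sf (x := z); rewrite es ezw pz => -> //.
  by rewrite -pz.
(* Triangles avoiding [w] agree; in [e] none passes through [w], as [z] and [a] are not adjacent,
   while in [f] the vertices [w], [p z], [p w2] form one. *)
rewrite (card_indeps (compl e) 3 w) (card_indeps (compl f) 3 w).
rewrite (card_iso_indeps_off (card_iso_compl ep)).
rewrite -addSn leq_add2r.
have -> : #|indeps_at (compl e) 3 w| = 0.
  apply/eqP; rewrite cards_eq0; apply/eqP/setP => K; rewrite !inE.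
  apply/negP => /andP[/andP[/eqP K3 /indepP eK] wK].
  have adj x y : x \in K -> y \in K -> x != y -> e x y.
    by move=> xK yK xy; have := eK x y xK yK; rewrite /compl xy negbK.
  have : #|K :\ w| == 2 by apply/eqP; have := cardsD1 w K; rewrite wK K3; case.
  case/cards2P=> u [v [uv Kuv]].
  have /setD1P[uw uK] : u \in K :\ w by rewrite Kuv !inE eqxx.
  have /setD1P[vw vK] : v \in K :\ w by rewrite Kuv !inE eqxx orbT.
  have eza : e z a = false.
    rewrite zE; apply/negbTE/norP; split.
      by apply/eqP => aw; have := wE a; rewrite aw ei eqxx orbT.
    by apply: contraNneq ea => ->; rewrite ew2.
  have := adj _ _ uK vK uv.
  have := adj _ _ wK uK; have := adj _ _ wK vK; rewrite ![w == _]eq_sym uw vw !wE.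
  move=> /(_ isT)/orP[]/eqP vE /(_ isT)/orP[]/eqP uE; rewrite uE vE ?eza //.
  - by rewrite ei.
  - by rewrite es eza.
  by rewrite ei.
apply/card_gt0P; exists (w |: [set p z; p w2]); rewrite !inE eqxx andbT.
rewrite cardsU1 cards2 !inE !negb_or ![w == _]eq_sym !(card_iso_eq ep) zw w2w.
rewrite (inj_eq perm_inj) [z == w2]eq_sym (negPf w2z) /=.
apply/indepP => x y; rewrite !inE.
by move=> /or3P[]/eqP -> /or3P[]/eqP ->;
  rewrite /compl ?eqxx ?[f (p z) w]fs ?[f (p w2) w]fs ?[f (p w2) (p z)]fs ?fwz ?fww2 ?fzw2 ?andbF.
Qed.

(** With a single vertex outside, a member of the set would have at most one neighbour. *)
Lemma indeps_pred_card e : simple e -> (forall x, 2 <= deg e x) -> 1 < #|T| ->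
  #|indeps e #|T|.-1| = 0.
Proof.
move=> [es ei] e2 T1; apply/eqP; rewrite cards_eq0; apply/eqP/setP => K.
rewrite !inE; apply/negP => /andP[/eqP Kn /indepP eK].
have [x xK] : exists x, x \in K by apply/card_gt0P; rewrite Kn; case: #|T| T1 => [|[]].
have : nbr e x \subset ~: K.
  by apply/subsetP => y; rewrite !inE => exy; apply: contraL exy; apply: eK.
move/subset_leq_card; rewrite -/(deg e x) => /(leq_trans (e2 x)).
by have := cardsC K; rewrite Kn; clear -T1; lia.
Qed.

Lemma missing_min e f z m r :
  hypomorphic e f z -> deg e =1 deg f -> (forall x, m <= deg e x) -> deg e z = m ->
  1 < #|T| -> #|[set x | deg e x == m]| + r != #|T| -> #|indeps e r| = #|indeps f r|.
Proof.
wlog lt_fe : e f / #|indeps f r| < #|indeps e r|.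
  move=> wl h ef m_min ez T1 rn.
  case: (ltngtP #|indeps f r| #|indeps e r|) => [lt|lt|//]; first exact: wl.
  apply/esym/wl; rewrite -?ef //; first exact: hypo_sym.
    by move=> x; rewrite -ef.
  by rewrite (eq_card (B := [set x | deg e x == m])) // => x; rewrite !inE ef.
move=> h ef m_min ez T1 rn; have [se sf isos] := h.
have [m0|m0] := posnP m.
  by apply: (missing_isolated h) => //; rewrite -m0.
apply/eqP; rewrite eqn_leq [X in _ && X]ltnW // andbT leqNgt; apply/negP => _.
have eD := esym (subnKC (ltnW lt_fe)).
have D0 : 0 < #|indeps e r| - #|indeps f r| by rewrite subn_gt0.
move: (_ - _) eD D0 => D eD D0.
have neq : \sum_(x | deg e x == m) #|indeps_at e r x|
    <> \sum_(x | deg e x == m) #|indeps_at f r x|.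
  move=> eq_sum; have := hypo_sum_min_shift h ez eD; rewrite eq_sum => /addnI/eqP.
  by rewrite eqn_pmul2r // eq_sym (negPf rn).
have hs := hypo_sym h; have fe x := esym (ef x).
have fm x : m <= deg f x by rewrite -ef.
have fz : deg f z = m by rewrite -ef.
have fA (u : T -> nat) : \sum_(x | deg e x == m) u x = \sum_(x | deg f x == m) u x.
  by apply: eq_bigl => x; rewrite ef.
(* Unequal sums give a value more frequent in [e] and another more frequent in [f], so the
   neighbours of [z] are concentrated in both graphs. *)
have [t lt_t] := sum_neq_count neq.
have nz := missing_nbrs_concentrated h ef m_min ez lt_t.
have [s lt_s] := sum_neq_count (not_eq_sym neq); rewrite !fA in lt_s.
have nfz := missing_nbrs_concentrated hs fe fm fz lt_s.
have bad_e i : i != z -> deg e i = m -> exists2 x, e i x & deg e x != m.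
  move=> iz im; case: (pickP [pred x | e i x && (deg e x != m)]) => [x /andP[]|good].
    by exists x.
  move: lt_fe; rewrite (min_deg_nbrs_iso h ef m_min r iz im) ?ltnn // => x eix.
  by have := good x; rewrite /= eix => /negbFE/eqP.
have bad_f i : i != z -> deg f i = m -> exists2 x, f i x & deg f x != m.
  move=> iz im; case: (pickP [pred x | f i x && (deg f x != m)]) => [x /andP[]|good].
    by exists x.
  move: lt_fe; rewrite (min_deg_nbrs_iso hs fe fm r iz im) ?ltnn // => x eix.
  by have := good x; rewrite /= eix => /negbFE/eqP.
have m2 := missing_min_le2 h ef m_min ez m0 eD D0 nz.
have [w ezw] : exists w, e z w.
  have /card_gt0P[w] : 0 < #|nbr e z| by rewrite -[#|_|]/(deg e z) ez.
  by rewrite inE; exists w.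
have [w' fzw'] : exists w', f z w'.
  have /card_gt0P[w'] : 0 < #|nbr f z| by rewrite -[#|_|]/(deg f z) fz.
  by rewrite inE; exists w'.
have [es ei] := se.
have [ew _] := nz w ezw.
have wz : w != z by apply: contraTneq ezw => ->; rewrite ei.
have [m1|m1] := eqVneq m 1.
  (* The only neighbour of [w] is [z], itself of minimum degree. *)
  have [x ewx] := bad_e w wz ew; rewrite m1 in ew.
  move: ew => /eqP/cards1P[y nw].
  have nwE v : e w v = (v == y) by have := in_set1 v y; rewrite -nw inE.
  move: ewx; rewrite nwE => /eqP ->.
  by have := nwE z; rewrite es ezw => /esym/eqP <-; rewrite ez eqxx.
have {m0 m1 m2} m2 : m = 2 by clear -m0 m1 m2; lia.
rewrite m2 in m_min fm ez fz bad_e bad_f.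
have nz2 x : e z x -> deg e x = 2 by rewrite -m2 => /nz[].
have nfz2 x : f z x -> deg f x = 2 by rewrite -m2 => /nfz[].
have eq_at : #|indeps_at e r z| = #|indeps_at f r z|.
  case: (deg_min_nbrs2 r h ef m_min nz2 ez ezw bad_e bad_f) => // lt1.
  case: (deg_min_nbrs2 r hs fe fm nfz2 fz fzw' bad_f bad_e) => // lt2.
  by have := ltn_trans lt1 lt2; rewrite ltnn.
(* Equality at [z] leaves only [r = n - 1], a size that minimum degree 2 rules out. *)
have := hypo_shift_missing h eD; rewrite eq_at => /addnI/eqP.
rewrite eqn_pmul2r // => /eqP rT; move: lt_fe.
by rewrite rT (indeps_pred_card se).
Qed.

End MissingDegreeTwo.

(** * From decks to vertex bijections *)

Lemma hypo_indeps_eq (T : finType) (e f : rel T) (z x0 : T) (m r : nat) :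
  hypomorphic e f z -> 7 <= #|T| -> (forall x, m <= deg e x) -> deg e x0 = m ->
  #|[set x | deg e x == m]| + r != #|T| -> #|indeps e r| = #|indeps f r|.
Proof.
move=> h n7 m_min ex0 rn; have ef := hypo_deg_eq h n7.
have [ez|ez] := eqVneq (deg e z) m; last exact: (missing_not_min r h ef m_min ez ex0).
by apply: (missing_min h ef m_min ez) => //; apply: leq_trans n7.
Qed.

Lemma count_le_map (A : finType) (U : eqType) (f : A -> U) (u : seq U) :
  (forall a, count_mem a u <= count_mem a [seq f x | x : A]) ->
  exists2 s : seq A, uniq s & perm_eq u (map f s).
Proof.
move/count_subseqP => [_ /subseqP[b _ ->] us].
exists (mask b (enum A)); first by rewrite mask_uniq ?enum_uniq.
by rewrite map_mask.
Qed.

Lemma uniq_notin_eq (A : finType) (s : seq A) (x y : A) :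
  uniq s -> #|A| <= (size s).+1 -> x \notin s -> y \notin s -> x = y.
Proof.
move=> us sA xs ys; apply/eqP; apply: contraT => xy.
have : uniq [:: x, y & s] by rewrite /= inE negb_or xy xs ys.
by move/card_uniqP => /= cs; have := max_card [in [:: x, y & s]]; rewrite cs ltnNge sA.
Qed.

(** At most one element on each side is unmatched; sending one to the other completes the matching
    to a bijection. *)
Lemma matching_bij (A B : finType) (U : eqType) (f : A -> U) (g : B -> U)
    (s : seq A) (t : seq B) :
  #|A| = #|B| -> 0 < #|A| -> uniq s -> uniq t -> #|A| <= (size s).+1 ->
  perm_eq (map f s) (map g t) ->
  exists z, exists2 h : A -> B, bijective h & forall x, x != z -> f x = g (h x).
Proof.
move=> AB A0 us ut sA fg; have [a _] := card_gt0P A0.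
have [b _] : exists b : B, b \in B by apply/card_gt0P; rewrite -AB.
have size_st : size s = size t by have := perm_size fg; rewrite !size_map.
(* The defaults [a] and [b] serve when the matching is already complete. *)
pose z := odflt a [pick x | x \notin s]; pose w := odflt b [pick y | y \notin t].
have [I pI fI] := perm_iotaP (g w) fg.
rewrite size_map in pI.
pose t' := [seq nth w t i | i <- I].
have tt' : perm_eq t' t.
  by rewrite -[X in perm_eq _ X](mkseq_nth w t); apply: perm_map.
have ut' : uniq t' by rewrite (perm_uniq tt').
have size_st' : size s = size t' by rewrite (perm_size tt').
have {}fI : map f s = map g t'.
  rewrite fI -map_comp; apply/eq_in_map => i; rewrite (perm_mem pI) mem_iota => /andP[_ it].
  by rewrite /= (nth_map w).
have zs x : x != z -> x \in s.
  apply: contraNT => xs; apply/eqP/(uniq_notin_eq us sA xs).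
  by rewrite /z; case: pickP => [//|/(_ x)]; rewrite xs.
have wt y : y \notin t' -> w \notin t'.
  rewrite !(perm_mem tt') => yt.
  by rewrite /w; case: pickP => [//|/(_ y)]; rewrite yt.
(* For [x] outside [s] the index is [size s], so [nth] returns its default [w]. *)
exists z, (fun x => nth w t' (index x s)); last first.
  move=> x /zs xs; rewrite -(nth_map w (f x)) -?size_st' ?index_mem // -fI.
  by rewrite (nth_map x) ?index_mem // nth_index.
apply: inj_card_bij; last by rewrite AB.
have nth_in x y : x \in s -> y \notin s ->
    nth w t' (index x s) = nth w t' (index y s) -> x = y.
  move=> xs ys; rewrite [RHS]nth_default; last first.
    by rewrite -size_st' leqNgt index_mem.
  move=> xw; have : w \in t' by rewrite -xw mem_nth // -size_st' index_mem.
  have [b' b't|all_t] := pickP [pred y | y \notin t'].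
    by rewrite (negPf (wt b' b't)).
  have : #|B| <= #|t'|.
    by apply/subset_leq_card/subsetP => v _; apply/negbFE/all_t.
  have /card_uniqP ys_size : uniq (y :: s) by rewrite /= ys us.
  rewrite (card_uniqP ut') -size_st' -AB leqNgt.
  by have := max_card [in y :: s]; rewrite ys_size => ->.
move=> x y; case xs: (x \in s); case ys: (y \in s) => eq_xy.
- by move/eqP: eq_xy; rewrite nth_uniq -?size_st' ?index_mem // => /eqP /index_inj; apply.
- by apply: nth_in; rewrite ?ys.
- by apply/esym/nth_in; rewrite ?xs.
by apply: (uniq_notin_eq us sA); rewrite ?xs ?ys.
Qed.

Lemma card_card_graph (G : sgraph) (v : G) : #|card_graph v| = #|G|.-1.
Proof. by rewrite card_sig -(cardsC1 v); apply: eq_card => x; rewrite !inE. Qed.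

Lemma common_deck_bij (G H : sgraph) :
  1 < #|G| -> #|G| - 1 <= common_cards G H ->
  exists z, exists2 h : G -> H, bijective h &
    forall v : G, v != z -> isomorphic (card_graph v) (card_graph (h v)).
Proof.
rewrite /common_cards => G1; set M := (_ `&` _)%mset => GM.
have [s us Ms] : exists2 s : seq G, uniq s &
    perm_eq M [seq unlabel (card_graph v) | v <- s].
  apply: (@count_le_map _ _ (fun v => unlabel (card_graph v))) => a.
  by rewrite count_mem_mset msetE2 mset_seqE geq_minl.
have [t ut Mt] : exists2 t : seq H, uniq t &
    perm_eq M [seq unlabel (card_graph v) | v <- t].
  apply: (@count_le_map _ _ (fun v => unlabel (card_graph v))) => a.
  by rewrite count_mem_mset msetE2 !mset_seqE geq_minr.
have st := perm_trans (_ : perm_eq _ M) Mt.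
rewrite perm_sym in Ms; have {}st := st _ Ms.
have sM : size s = size M by rewrite -(perm_size Ms) size_map.
(* A common card exists and has one vertex fewer than either graph. *)
have GH : #|G| = #|H|.
  have s0 : 0 < size s by rewrite sM; apply: leq_trans GM; rewrite subn_gt0.
  case: s s0 {us sM Ms} st => // v s _ st.
  have : unlabel (card_graph v) \in [seq unlabel (card_graph v) | v <- t].
    by rewrite -(perm_mem st) mem_head.
  case/mapP => w _ /(congr1 (@tag _ _)) /=; rewrite !card_card_graph.
  have : 0 < #|H| by apply/card_gt0P; exists w.
  by case: #|G| G1 => // n _; case: #|H| => // m _ /= ->.
have [||z [h h_bij hE]] := matching_bij GH _ us ut _ st; first exact: ltnW.
  by rewrite sM -add1n -leq_subLR.
by exists z, h => // v /hE /unlabel_eqP.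
Qed.

(** * Passage to complements on one vertex set *)

Lemma clique_indep (G : sgraph) (K : {set G}) : clique K = indep (compl (@adj G)) K.
Proof.
have E x y : ((x != y) ==> adj x y) = ~~ compl (@adj G) x y.
  by rewrite /compl; case: (x != y); case: (adj x y).
apply/forall_inP/indepP => [cK x y xK yK | eK x xK].
  by rewrite -E; apply: (forall_inP (cK x xK)).
by apply/forall_inP => y yK; rewrite E eK.
Qed.

Lemma kcount_indeps (G H : sgraph) (h : G -> H) (r : nat) : bijective h ->
  kcount r H = #|indeps (compl (relpre h (@adj H))) r|.
Proof.
move=> h_bij; have h_inj := bij_inj h_bij; have [h' hK h'K] := h_bij.
rewrite -(card_imset _ (imset_inj h_inj)); apply: eq_card => K.
have imh (L : {set G}) : clique (h @: L) = indep (compl (relpre h (@adj H))) L.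
  rewrite clique_indep; apply/indepP/indepP.
    move=> hL x y xL yL; have := hL _ _ (imset_f h xL) (imset_f h yL).
    by rewrite /compl /= (inj_eq h_inj).
  move=> L_ind _ _ /imsetP[x xL ->] /imsetP[y yL ->].
  by have := L_ind _ _ xL yL; rewrite /compl /= (inj_eq h_inj).
apply/idP/imsetP => [|[L]].
  have KE : K = h @: (h @^-1: K).
    apply/setP => y; apply/idP/imsetP => [yK|[x]]; last by rewrite inE => xK ->.
    by exists (h' y); rewrite ?inE h'K.
  rewrite inE KE imh card_imset // => KL; exists (h @^-1: K) => //.
  by rewrite inE.
by rewrite !inE => LI ->; rewrite imh card_imset.
Qed.

Lemma hypomorphic_of_bij (G H : sgraph) (h : G -> H) (z : G) : bijective h ->
  (forall v, v != z -> isomorphic (card_graph v) (card_graph (h v))) ->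
  hypomorphic (@adj G) (relpre h (@adj H)) z.
Proof.
move=> [h' hK h'K] isos.
split=> [||i /isos[k k_bij k_mono]]; first by split; [apply: adj_sym | apply: adj_irr].
  by split=> [x y|x] /=; [apply: adj_sym | apply: adj_irr].
(* Follow the isomorphism of cards and return along [h']; the vertex [i], outside its card, gets the
   default [i]. *)
pose q (x : G) : G := if insub x is Some u then h' (val (k u)) else i.
pose S : Type := {x : G | x \in [set~ i]}.
have qE (u : S) : q (val u) = h' (val (k u)) by rewrite /q valK.
have qi : q i = i by rewrite /q insubF // !inE eqxx.
have sub x : x != i -> exists u : S, x = val u.
  move=> xi; have xi' : x \in [set~ i] by rewrite !inE.
  by exists (Sub x xi').
have q_inj : injective q.
  have k_neq (u : S) : q (val u) != i.
    have := valP (k u); rewrite !inE qE; apply: contraNneq => /(congr1 h).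
    by rewrite h'K => ->.
  move=> x y; have [->|/sub[u ->]] := eqVneq x i; have [->|/sub[v ->]] := eqVneq y i => //.
  - by rewrite qi => /esym/eqP; rewrite (negPf (k_neq v)).
  - by rewrite qi => /eqP; rewrite (negPf (k_neq u)).
  by rewrite !qE => /(can_inj h'K)/val_inj/(bij_inj k_bij) ->.
exists (perm q_inj); split=> [|x y /sub[u ->] /sub[v ->]]; first by rewrite permE.
by rewrite !permE !qE /= !h'K; apply: k_mono.
Qed.

Theorem theorem1p6 (G : sgraph) (n l r : nat) :
  #|G| = n -> 7 <= n -> num_max_degree G = l ->
  1 <= r -> r <> n - l ->
  reconstructible_from (kcount r) (n - 1) G.
Proof.
move=> Gn n7 Gl _ rnl H common.
have G0 : 0 < #|G| by rewrite Gn; apply: leq_trans n7.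
have [||z [h h_bij isos]] := @common_deck_bij G H; rewrite ?Gn //.
  by apply: leq_trans n7.
have hyp := hypo_compl (hypomorphic_of_bij h_bij isos).
rewrite (kcount_indeps r h_bij) (@kcount_indeps G G id r) //; last by exists id.
have sG : simple (@adj G) by have [[]] := hypomorphic_of_bij h_bij isos.
have degG x : degree x + deg (compl (@adj G)) x = n.-1.
  by rewrite -Gn -(deg_compl x sG).
have le_max x : degree x <= max_degree G := leq_bigmax x.
have [x0 x0_max] := eq_bigmax (@degree G) G0.
apply/esym; apply: (hypo_indeps_eq (x0 := x0) (m := n.-1 - max_degree G) hyp).
- by rewrite Gn.
- by move=> x; rewrite leq_subLR -(degG x) leq_add2r.
- by rewrite -(degG x0) /max_degree x0_max addKn.
rewrite (_ : #|_| = l); last first.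
  rewrite -Gl; apply: eq_card => x; rewrite !inE -(degG x0) /max_degree x0_max.
  have := degG x; have := degG x0; have := le_max x.
  by rewrite /max_degree x0_max; clear; lia.
(* Since [n - l] does not truncate, [l + r = n] would give [r = n - l]. *)
have ln : l <= n by rewrite -Gl -Gn max_card.
by apply/eqP => rn; apply: rnl; rewrite -Gn -rn addKn.
Qed.
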